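(* Let $G$ be a finite connected undirected graph (multiple edges and loops allowed), let $<$ be a total order on $E(G)$ and let $A$ be a full orientation of $G$. Each partial orientation $\mathcal{O}$ of $G$ is equivalent via cycle reversals and edge pivots to a unique partial orientation that is cycle-path minimal with respect to $(<,A)$.
   Context: A partial orientation of $G$ is an orientation of a subset of the edges; the remaining edges are unoriented (each edge, including each loop, has two possible orientations or is unoriented; an oriented loop at $v$ is oriented towards $v$ in either orientation). A full orientation orients every edge. A directed cycle in a partial orientation is a cycle of $G$ all of whose edges are oriented, consistently along the cycle; an oriented loop is a directed cycle of length 1, and two parallel edges oriented oppositely form a directed cycle of length 2. A cycle reversal reverses the orientation of all edges in a directed cycle. Given a vertex $v$ incident to an unoriented edge $e$ and an edge $e'$ oriented towards $v$, an edge pivot is the operation of unorienting $e'$ and orienting $e$ towards $v$. Two partial orientations are equivalent via cycle reversals and edge pivots if one can be obtained from the other by a finite (possibly empty) sequence of these operations. A half open path in a partial orientation consists of a directed path with at least one edge (a directed walk $v_0\to v_1\to\dots\to v_k$, $k\ge 1$, along distinct oriented edges) together with an unoriented edge $e$ incident to its terminal vertex $v_k$. When discussing the orientation of the edges in a half open path, $e$ is regarded as having the orientation that extends the path, i.e. pointing away from $v_k$ (if $e$ is a loop, either of its two orientations may be taken, giving two half open paths); so an unoriented edge may have different orientations in different half open paths. Given $(<,A)$, a directed cycle (respectively, a half open path) is minimal if its minimum edge with respect to $<$ is oriented in the same direction as in $A$. A partial orientation is cycle-path minimal if every directed cycle in it is minimal and every half open path in it is minimal. *)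

(* Defs.v *)
From Stdlib Require Import Relation_Operators.
From mathcomp Require Import all_boot all_order.

Set Implicit Arguments.
Unset Strict Implicit.
Unset Printing Implicit Defensive.

(** Finite undirected multigraphs with vertices [V] and edges [E].  The order
    of the two ends of an edge only serves to name its two directions. *)
Record multigraph (V E : finType) := Multigraph { end0 : E -> V; end1 : E -> V }.

(** An edge together with one of its two directions; a loop also has two
    distinct directions. *)
Definition dart (E : finType) : finType := (E * bool)%type.

Definition partial_orientation (E : finType) := {ffun E -> option bool}.

Section Orientations.
Variables (V E : finType) (G : multigraph V E).
Implicit Types (x y : dart E) (p c : seq (dart E)) (O : partial_orientation E).

(** [(e, true)] runs from [end0 e] to [end1 e], and [(e, false)] backwards. *)
Definition source x : V := if x.2 then end0 G x.1 else end1 G x.1.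
Definition target x : V := if x.2 then end1 G x.1 else end0 G x.1.

Definition adjacent : rel V :=
  fun u v => [exists x : dart E, (source x == u) && (target x == v)].

Definition connected : Prop := 0 < #|V| /\ forall u v, connect adjacent u v.

Definition follows : rel (dart E) := fun x y => target x == source y.

Definition edges p : seq E := [seq x.1 | x <- p].

Definition oriented O x : bool := O x.1 == Some x.2.

Definition unoriented O (e : E) : bool := O e == None.

Definition full O : Prop := forall e, ~~ unoriented O e.

(** A cycle of the graph, with a sense of traversal and a starting point. *)
Definition is_cycle c : bool :=
  [&& c != [::], cycle follows c, uniq [seq source x | x <- c] & uniq (edges c)].

Definition directed_cycle O c : bool := is_cycle c && all (oriented O) c.

Definition reverse O c : partial_orientation E :=
  [ffun e => if e \in edges c then omap negb (O e) else O e].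

Definition cycle_reversal O O' : Prop :=
  exists2 c, directed_cycle O c & O' = reverse O c.

(** [e] is [x.1] and [e'] is [y.1] in the usual description of an edge pivot.
    If [x.1] is a loop at [v], both choices of [x.2] orient it towards [v]. *)
Definition edge_pivot O O' : Prop :=
  exists v x y,
    [/\ unoriented O x.1, target x = v, oriented O y, target y = v &
        O' = [ffun f => if f == x.1 then Some x.2
                        else if f == y.1 then None else O f]].

Definition move O O' : Prop := cycle_reversal O O' \/ edge_pivot O O'.

(** Moves are reversible, so it does not matter which of the two partial
    orientations is obtained from the other. *)
Definition equivalent O O' : Prop :=
  clos_refl_trans (partial_orientation E) move O O'.

(** Vertices may be repeated along [p].  The direction of [x] is the one that
    extends [p]; if [x.1] is a loop, both directions are allowed. *)
Definition half_open_path O p x : bool :=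
  [&& p != [::], sorted follows (rcons p x), uniq (edges p),
      all (oriented O) p & unoriented O x.1].

End Orientations.

Section Minimality.
Variables (V : finType) (d : Order.disp_t) (E : finOrderType d).
Variables (G : multigraph V E) (A : partial_orientation E).

Definition minimal (p : seq (dart E)) : Prop :=
  exists x : dart E,
    [/\ x \in p, forall y : dart E, y \in p -> (x.1 <= y.1)%O & oriented A x].

Definition cycle_path_minimal (O : partial_orientation E) : Prop :=
  (forall c, directed_cycle G O c -> minimal c) /\
  (forall p x, half_open_path G O p x -> minimal (rcons p x)).

End Minimality.

(* Main.v *)
Require Import Defs.
From Stdlib Require Import Relation_Operators Classical.
From mathcomp Require Import all_boot all_order.

Set Implicit Arguments.
Unset Strict Implicit.
Unset Printing Implicit Defensive.

(** Existence and uniqueness rest on two different ideas.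

    Existence: order the partial orientations lexicographically, the smallest
    edge being the most significant and each edge ranking higher when oriented
    as in [A] than when unoriented, and higher when unoriented than when
    oriented against [A].  A violation of minimality always yields a sequence
    of moves that climbs in this order ([improve_cycle], [improve_path]).  A
    cycle whose least edge is badly oriented gets reversed.  A half open path
    whose least edge is badly oriented is cut so that it starts at that edge;
    pivoting all along it from its end then makes that edge unoriented
    ([push_unoriented]).  If the least edge is the unoriented one, a single
    pivot with its predecessor orients it as in [A].  The order is finite, so
    climbing stops, at a cycle-path minimal partial orientation.

    Uniqueness: moves preserve the indegree of every vertex, hence the number
    of edges oriented into any set of vertices ([equivalent_indegree]).  Let
    [O1] and [O2] be cycle-path minimal with the same indegrees, and suppose
    that they differ; let [x0] be the least edge at which they do so, with its
    direction in [O1] (exchanging the two if necessary).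
    Starting at the head of [x0], follow the edges that [O1] and [O2] orient
    oppositely, in their [O1] direction.  Either this comes back to the tail
    of [x0], closing a directed cycle of [O1], or counting the edges that
    enter the set of vertices reached exhibits an edge which leaves that set
    and is unoriented in [O1], closing a half open path of [O1].  All edges
    of this cycle or path are edges where [O1] and [O2] differ, so [x0] is the
    least of them and must be directed as in [A] ([oriented_diff_agrees]).
    If [O2] reverses [x0], the same applies to [O2], and [A] has both
    directions of [x0].  If [O2] leaves [x0] unoriented, equality of indegrees
    at the head of [x0] gives an edge that [O2] orients towards that head and
    [O1] does not; followed by [x0] backwards it is a half open path of [O2],
    so [A] again contains the reverse of [x0] ([unoriented_diff_agrees]). *)

Definition flip (E : finType) (x : dart E) : dart E := (x.1, ~~ x.2).

(** * Indegrees and moves *)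

Section Indegree.
Variables (V E : finType) (G : multigraph V E).
Implicit Types (x y : dart E) (p c q : seq (dart E)).
Implicit Types (O : partial_orientation E).
Implicit Types (S : {pred V}).

Lemma target_flip x : target G (flip x) = source G x.
Proof. by case: x => e []. Qed.

Lemma source_flip x : source G (flip x) = target G x.
Proof. by case: x => e []. Qed.

Lemma oriented_flip O x : O x.1 != None -> oriented O x || oriented O (flip x).
Proof. by case: x => e b; rewrite /oriented /=; case: (O e) b => [[]|] []. Qed.

Lemma oriented_inj O : {in oriented O &, injective (fun x => x.1)}.
Proof.
move=> [e b] [f b']; rewrite !unfold_in /oriented /= => /eqP Ox /eqP Oy ef.
by move: Oy; rewrite -ef Ox => -[->].
Qed.

Lemma uniq_edges_oriented O p : all (oriented O) p -> uniq (edges p) = uniq p.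
Proof.
move=> /allP Op; apply: map_inj_in_uniq => x y /Op Ox /Op Oy.
exact: oriented_inj Ox Oy.
Qed.

(** Stated for edges rather than darts, and for a set of vertices rather than
    a single one, so that the indegrees of two partial orientations are sums
    over the same indices and can be compared term by term. *)
Definition enters O S (e : E) : bool :=
  if O e is Some b then target G (e, b) \in S else false.

Definition indegree O S : nat := \sum_e enters O S e.

Lemma enters_oriented O S x :
  oriented O x -> enters O S x.1 = (target G x \in S).
Proof. by case: x => e b /eqP; rewrite /enters /= => ->. Qed.

Lemma enters_unoriented O S e : unoriented O e -> enters O S e = false.
Proof. by rewrite /enters => /eqP ->. Qed.

(** Along a closed walk the targets are the sources, shifted by one. *)
Lemma count_cycle c S : cycle (follows G) c ->
  \sum_(x <- c) (target G x \in S) = \sum_(x <- c) (source G x \in S).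
Proof.
case: c => [|x c]; first by rewrite !big_nil.
rewrite /=.
have gen : forall y p z, path (follows G) y (rcons p z) ->
  \sum_(t <- y :: p) (target G t \in S) =
  \sum_(t <- rcons p z) (source G t \in S).
  move=> y p z; elim: p y => [|t p IHp] y /=.
    by rewrite !big_cons !big_nil => /andP[/eqP->].
  by case/andP=> /eqP yt /IHp IH; rewrite big_cons IH yt big_cons.
by move/gen->; rewrite big_rcons big_cons /= addnC.
Qed.

(** Off the cycle nothing changes; on it, the number of edges with target in
    [S] becomes the number of edges with source in [S], which is the same. *)
Lemma reverse_indegree O c S :
  directed_cycle G O c -> indegree (reverse O c) S = indegree O S.
Proof.
case/andP=> /and4P[_ cyc_c _ uniq_c] /allP Oc.
rewrite /indegree (bigID (mem (edges c))) [RHS](bigID (mem (edges c))) /=.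
congr (_ + _); last first.
  apply: eq_bigr => e /negbTE ec.
  by rewrite /enters ffunE ec.
rewrite -!big_uniq // !big_map.
rewrite (eq_big_seq (fun x => nat_of_bool (source G x \in S))); last first.
  move=> x xc; rewrite -target_flip -(@enters_oriented (reverse O c)) //.
  by rewrite /oriented ffunE /= map_f // (eqP (Oc x xc)).
rewrite -count_cycle //; apply: eq_big_seq => x xc.
by rewrite (enters_oriented _ (Oc x xc)).
Qed.

Definition pivot O x y : partial_orientation E :=
  [ffun f => if f == x.1 then Some x.2 else if f == y.1 then None else O f].

Lemma oriented_unoriented_neq O x y :
  unoriented O x.1 -> oriented O y -> x.1 != y.1.
Proof.
by move=> /eqP Ox Oy; apply/eqP => xy; move: Oy; rewrite /oriented -xy Ox.
Qed.

Lemma pivot_indegree O x y S :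
  unoriented O x.1 -> oriented O y -> target G x = target G y ->
  indegree (pivot O x y) S = indegree O S.
Proof.
move=> Ox Oy xy; have neq_xy := oriented_unoriented_neq Ox Oy.
have neq_yx : y.1 != x.1 by rewrite eq_sym.
rewrite /indegree (bigD1 x.1) // (bigD1 y.1) //=.
rewrite [RHS](bigD1 x.1) // [in RHS](bigD1 y.1) //= !addnA; congr (_ + _).
  rewrite (enters_unoriented _ Ox) (enters_oriented _ Oy) -xy.
  rewrite (@enters_oriented _ _ x) ?(@enters_unoriented _ _ y.1) ?addn0 //.
    by rewrite /unoriented ffunE (negbTE neq_yx) eqxx.
  by rewrite /oriented ffunE eqxx.
apply: eq_bigr => e /andP[/negbTE ex /negbTE ey].
by rewrite /enters ffunE ex ey.
Qed.

Lemma equivalent_indegree O O' S :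
  equivalent G O O' -> indegree O S = indegree O' S.
Proof.
elim=> [{}O {}O' [[c cyc_c ->]|] | // | O1 O2 O3 _ -> _ -> //].
  by rewrite reverse_indegree.
case=> v [x [y [Ox xv Oy yv ->]]].
by rewrite -(pivot_indegree S Ox Oy) // xv yv.
Qed.

Lemma pivot_equivalent O x y :
  unoriented O x.1 -> oriented O y -> follows G y x ->
  equivalent G O (pivot O (flip x) y).
Proof.
move=> Ox Oy /eqP yx; apply: rt_step; right.
by exists (target G y), (flip x), y; split; rewrite // target_flip.
Qed.

(** Pivoting at every vertex of a half open path, from its end to its start,
    moves the unoriented edge to the start; every other edge is reversed. *)
Lemma push_unoriented O y q x : half_open_path G O (y :: q) x ->
  exists O', [/\ equivalent G O O', unoriented O' y.1 &
                 {in [predC edges (rcons (y :: q) x)], O' =1 O}].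
Proof.
elim/last_ind: q O x => [|q z IHq] O x.
  case/and5P=> _ /= /andP[yx _] _ /andP[Oy _] Ox.
  have neq_yx : (y.1 == x.1) = false.
    by rewrite eq_sym; apply/negbTE/(oriented_unoriented_neq Ox Oy).
  exists (pivot O (flip x) y); split; first exact: pivot_equivalent.
    by rewrite /unoriented ffunE /= neq_yx eqxx.
  move=> f; rewrite !inE negb_or => /andP[/negbTE fy /negbTE fx].
  by rewrite ffunE /= fx fy.
rewrite /half_open_path -rcons_cons /edges map_rcons rcons_uniq all_rcons.
case/and5P=> _ + /andP[z_notin uniq_yq] /andP[Oz Oyq] Ox.
rewrite /= rcons_path last_rcons => /andP[yqz zx].
have Oyqz t : t \in rcons (y :: q) z -> oriented O t.
  by rewrite mem_rcons in_cons => /predU1P[-> //|]; apply: (allP Oyq).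
have neq_x t : t \in rcons (y :: q) z -> (t.1 == x.1) = false.
  by move=> /Oyqz Ot; rewrite eq_sym; apply/negbTE/(oriented_unoriented_neq Ox).
have [|O' [O1O' O'y O'E]] := IHq (pivot O (flip x) z) z.
  apply/and5P; split=> //.
    apply/allP=> t t_in; rewrite /oriented ffunE neq_x; last first.
      by rewrite mem_rcons in_cons t_in orbT.
    case: (t.1 =P z.1) => [tz|_]; last exact: (allP Oyq _ t_in).
    by case/negP: z_notin; rewrite -tz map_f.
  by rewrite /unoriented ffunE neq_x ?eqxx // mem_rcons mem_head.
exists O'; split=> [|//|f].
  by apply: rt_trans O1O'; apply: pivot_equivalent.
rewrite map_rcons inE -rcons_cons mem_rcons in_cons negb_or.
case/andP=> fx f_notin.
rewrite O'E //= ffunE (negbTE fx); case: eqP => // fz; case/negP: f_notin.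
rewrite fz; apply: (@map_f _ _ _ (rcons (y :: q) z)).
by rewrite mem_rcons mem_head.
Qed.

(** Shortening the walk makes its vertices distinct, which yields both the
    distinct edges of a half open path and the distinct sources of a cycle. *)
Lemma connect_darts (P : pred (dart E)) x v :
  connect (fun u w => [exists y, [&& P y, source G y == u & target G y == w]])
    (target G x) v ->
  exists q, [/\ all P q, path (follows G) x q, target G (last x q) = v &
                uniq [seq target G y | y <- x :: q]].
Proof.
case/connectP=> s path_s ->; case/shortenP: path_s => {s} s path_s uniq_s _.
suff [q [Pq path_q target_q]] : exists q,
    [/\ all P q, path (follows G) x q & [seq target G y | y <- q] = s].
  by exists q; rewrite /= target_q; split; rewrite // -target_q last_map.
elim: s x path_s {uniq_s} => [|w s IHs] x /=; first by exists [::].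
case/andP=> /existsP[y /and3P[Py /eqP yx /eqP yw]].
rewrite -yw => /IHs[q [Pq path_q target_q]].
by exists (y :: q); rewrite /= Py Pq path_q /follows yx eqxx target_q.
Qed.

Lemma source_target_path x q : path (follows G) x q ->
  rcons [seq source G y | y <- q] (target G (last x q)) =
  [seq target G y | y <- x :: q].
Proof. by elim: q x => //= y q IHq x /andP[/eqP-> /IHq->]. Qed.

End Indegree.

Section Minimality.
Variables (V : finType) (d : Order.disp_t) (E : finOrderType d).
Variables (G : multigraph V E) (A : partial_orientation E).
Implicit Types (x y : dart E) (p c q : seq (dart E)).
Implicit Types (O : partial_orientation E).

Lemma minimal_agrees p x : minimal A p -> uniq (edges p) -> x \in p ->
  (forall y, y \in p -> (x.1 <= y.1)%O) -> oriented A x.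
Proof.
case=> y [yp miny Ay] uniq_p xp minx.
suff -> : x = y by [].
apply: contraTeq uniq_p => neq_xy; apply/negP => uniq_p.
have xy : x.1 = y.1 by apply: Order.POrderTheory.le_anti; rewrite minx ?miny.
case/negP: neq_xy; apply/eqP; move: xp yp uniq_p xy; clear.
elim: p => //= z p IHp; rewrite !inE => xp yp /andP[z_notin uniq_p] xy.
case/predU1P: xp yp xy => [->|xp] /predU1P[->|yp] // xy.
- by rewrite xy map_f in z_notin.
- by rewrite -xy map_f in z_notin.
exact: IHp.
Qed.

Lemma not_minimalP p : p != [::] -> ~ minimal A p ->
  exists x, [/\ x \in p, forall y, y \in p -> (x.1 <= y.1)%O & ~~ oriented A x].
Proof.
case: p => // x0 p _ not_min.
have x0p : x0 \in x0 :: p by rewrite mem_head.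
case: (Order.TotalTheory.arg_minP (P := mem (x0 :: p)) (fun x => x.1) x0p).
move=> x xp minx.
by exists x; split=> //; apply/negP=> Ax; case: not_min; exists x.
Qed.

(** * Uniqueness *)

Section Difference.
Variables (O1 O2 : partial_orientation E) (x0 : dart E).
Hypothesis indeg_eq : forall S, indegree G O1 S = indegree G O2 S.
Hypothesis O1x0 : oriented O1 x0.
Hypothesis diff_x0 : O1 x0.1 != O2 x0.1.
Hypothesis min_x0 : forall e, O1 e != O2 e -> (x0.1 <= e)%O.

(** [S] is the set of vertices reached from the head of [x0] along edges that
    [O1] and [O2] orient oppositely.  A walk in [S] back to the tail of [x0]
    gives a directed cycle; a walk to the head of an edge that [O2] orients
    into [S] and [O1] leaves unoriented gives a half open path.  One of the two
    exists, for otherwise more edges enter [S] in [O1] than in [O2]. *)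
Lemma oriented_diff_agrees : cycle_path_minimal G A O1 -> oriented A x0.
Proof.
case=> min_cycle min_path.
pose P y := oriented O1 y && oriented O2 (flip y).
pose S := [pred v | connect (fun u w => [exists y,
  [&& P y, source G y == u & target G y == w]]) (target G x0) v].
have P_diff y : P y -> O1 y.1 != O2 y.1.
  by case/andP=> /eqP-> /eqP /= ->; case: y.2.
have closedS y : P y -> source G y \in S -> target G y \in S.
  move=> Py /connect_trans; apply; apply/connect1/existsP.
  by exists y; rewrite Py !eqxx.
have x0S : target G x0 \in S by rewrite inE connect0.
have walk v : v \in S -> exists q,
    [/\ path (follows G) x0 q, target G (last x0 q) = v,
        uniq [seq target G y | y <- x0 :: q], all (oriented O1) (x0 :: q) &
        forall y, y \in x0 :: q -> (x0.1 <= y.1)%O].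
  case/connect_darts=> q [/allP Pq path_q last_q uniq_q].
  exists q; split=> //.
    by rewrite /= O1x0; apply/allP=> y /Pq /andP[].
  by move=> y; rewrite inE => /predU1P[-> //|/Pq/P_diff/min_x0].
have [/walk back|out] := boolP (source G x0 \in S).
  case: back => [q [path_q last_q uniq_q O1q minq]].
  have uniq_e : uniq (edges (x0 :: q)).
    by rewrite (uniq_edges_oriented O1q); apply: map_uniq uniq_q.
  apply: (minimal_agrees _ uniq_e (mem_head _ _) minq).
  apply: min_cycle; rewrite /directed_cycle O1q andbT.
  apply/and4P; split=> //.
    by rewrite /= rcons_path path_q /follows last_q eqxx.
  by rewrite /= -rcons_uniq -last_q source_target_path.
have [/existsP[y /and3P[O2y yS O1y]]|no_exit] := boolP
    [exists y, [&& oriented O2 y, target G y \in S & unoriented O1 y.1]].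
  have [q [path_q last_q uniq_q O1q minq]] := walk _ yS.
  have y_notin : y.1 \notin edges (x0 :: q).
    apply/negP=> /mapP[z /(allP O1q) O1z yz].
    by move: O1z; rewrite /oriented -yz (eqP O1y).
  have uniq_e : uniq (edges (x0 :: q)).
    by rewrite (uniq_edges_oriented O1q); apply: map_uniq uniq_q.
  apply: (@minimal_agrees (rcons (x0 :: q) (flip y))).
  - apply: min_path; apply/and5P; split=> //.
    by rewrite /= rcons_path path_q /follows last_q source_flip eqxx.
  - by rewrite /edges map_rcons rcons_uniq y_notin.
  - by rewrite mem_rcons inE mem_head orbT.
  move=> z; rewrite mem_rcons inE => /predU1P[-> /=|/minq //].
  by apply: min_x0; rewrite (eqP O1y) (eqP O2y).
(* Every edge entering S in O2 now enters S in O1 too, and x0 does so only in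
   O1. *)
have le_enters e : enters G O2 S e <= enters G O1 S e.
  case O2e: (O2 e) => [b|]; last first.
    by rewrite (@enters_unoriented _ _ G O2) // /unoriented O2e.
  have O2y : oriented O2 (e, b) by rewrite /oriented O2e.
  rewrite (enters_oriented _ _ O2y); case: (boolP (_ \in S)) => // yS.
  have O1e : O1 (e, b).1 != None.
    apply: contra no_exit => O1e; apply/existsP; exists (e, b).
    by rewrite O2y yS.
  have [O1y|O1y] := orP (oriented_flip O1e).
    by rewrite (enters_oriented _ _ O1y) yS.
  rewrite (enters_oriented _ _ O1y) closedS ?source_flip //.
  by rewrite /P O1y /oriented /= negbK O2e eqxx.
suff : indegree G O2 S < indegree G O1 S by rewrite indeg_eq ltnn.
rewrite /indegree (bigD1 x0.1) // [X in _ < X](bigD1 x0.1) //=.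
rewrite (enters_oriented _ _ O1x0) x0S -addSn leq_add ?leq_sum //.
rewrite ltnS leqn0 eqb0; apply: contra out => ent.
have O2x0 : O2 x0.1 != None.
  by apply: contraTN ent => /(enters_unoriented G S)->.
have [O2x|O2x] := orP (oriented_flip O2x0).
  by case/eqP: diff_x0; rewrite (eqP O1x0) (eqP O2x).
by rewrite -target_flip -(enters_oriented _ _ O2x).
Qed.

(** The head of [x0] has the same indegree in both, and [x0] counts only in
    [O1], so some other edge [y] counts only in [O2]; then [y] followed by the
    unoriented [x0] is a half open path of [O2]. *)
Lemma unoriented_diff_agrees :
  unoriented O2 x0.1 -> cycle_path_minimal G A O2 -> oriented A (flip x0).
Proof.
move=> O2x0 [_ min_path].
pose S := pred1 (target G x0).
have [/existsP[y /and3P[O2y yS O1y]]|none] := boolP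
    [exists y, [&& oriented O2 y, target G y \in S & ~~ oriented O1 y]].
  have neq_xy := oriented_unoriented_neq O2x0 O2y.
  apply: (@minimal_agrees [:: y; flip x0]).
  - apply: (min_path [:: y]); rewrite /half_open_path /= O2y O2x0 !andbT.
    by rewrite /follows source_flip.
  - by rewrite /= inE eq_sym neq_xy.
  - by rewrite !inE eqxx orbT.
  move=> z; rewrite !inE => /pred2P[]-> //=; apply: min_x0.
  by rewrite (eqP O2y).
have le_enters e : enters G O2 S e <= enters G O1 S e.
  case O2e: (O2 e) => [b|]; last first.
    by rewrite (@enters_unoriented _ _ G O2) // /unoriented O2e.
  have O2y : oriented O2 (e, b) by rewrite /oriented O2e.
  rewrite (enters_oriented _ _ O2y); case: (boolP (_ \in S)) => // yS.
  have O1y : oriented O1 (e, b).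
    by apply: contraR none => O1y; apply/existsP; exists (e, b); rewrite O2y yS.
  by rewrite (enters_oriented _ _ O1y) yS.
suff : indegree G O2 S < indegree G O1 S by rewrite indeg_eq ltnn.
rewrite /indegree (bigD1 x0.1) // [X in _ < X](bigD1 x0.1) //=.
rewrite (enters_oriented _ _ O1x0) inE eqxx -addSn leq_add ?leq_sum //.
by rewrite (enters_unoriented _ _ O2x0).
Qed.

End Difference.

Lemma oriented_flipF x : oriented A x -> oriented A (flip x) -> False.
Proof. by rewrite /oriented => /eqP-> /eqP[]; case: x.2. Qed.

Lemma cycle_path_minimal_inj O1 O2 :
  (forall S, indegree G O1 S = indegree G O2 S) ->
  cycle_path_minimal G A O1 -> cycle_path_minimal G A O2 -> O1 = O2.
Proof.
move=> indeg_eq min1 min2; apply/eqP/negPn/negP=> neq12.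
have [e0 diff_e0] : exists e, O1 e != O2 e.
  by apply/existsP; apply: contraR neq12 => /existsPn eq12;
     apply/eqP/ffunP=> e; apply/eqP/negPn.
case: (Order.TotalTheory.arg_minP (P := fun e => O1 e != O2 e) id diff_e0).
move=> e diff_e min_e {e0 diff_e0}.
have indeg_sym S : indegree G O2 S = indegree G O1 S by rewrite indeg_eq.
have diff_sym : O2 e != O1 e by rewrite eq_sym.
have min_sym f : O2 f != O1 f -> (e <= f)%O by rewrite eq_sym; apply: min_e.
case O1e: (O1 e) => [b1|]; case O2e: (O2 e) => [b2|].
- have O1x : oriented O1 (e, b1) by rewrite /oriented O1e.
  have O2x : oriented O2 (flip (e, b1)).
    move: diff_e; rewrite /oriented O1e O2e /=.
    by case: b1 b2 {O1e O2e O1x} => [] [].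
  apply: (@oriented_flipF (e, b1)).
    exact: (oriented_diff_agrees indeg_eq O1x diff_e min_e min1).
  exact: (oriented_diff_agrees indeg_sym O2x diff_sym min_sym min2).
- have O1x : oriented O1 (e, b1) by rewrite /oriented O1e.
  have O2x : unoriented O2 e by rewrite /unoriented O2e.
  apply: (@oriented_flipF (e, b1)).
    exact: (oriented_diff_agrees indeg_eq O1x diff_e min_e min1).
  exact: (unoriented_diff_agrees indeg_eq O1x min_e O2x min2).
- have O2x : oriented O2 (e, b2) by rewrite /oriented O2e.
  have O1x : unoriented O1 e by rewrite /unoriented O1e.
  apply: (@oriented_flipF (e, b2)).
    exact: (oriented_diff_agrees indeg_sym O2x diff_sym min_sym min2).
  exact: (unoriented_diff_agrees indeg_sym O2x min_sym O1x min1).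
by move: diff_e; rewrite O1e O2e.
Qed.

(** * Existence *)

(** An unoriented edge has to rank between the two directions: pushing along a
    half open path turns a badly oriented first edge into an unoriented one,
    and pivoting on the unoriented last edge orients it against the path, which
    is as in [A] when the path extends it against [A]. *)
Definition rank (e : E) (o : option bool) : nat :=
  if o == None then 1 else if o == A e then 2 else 0.

Definition better O O' : bool :=
  [exists e, [forall f, (f < e)%O ==> (O' f == O f)] &&
             (rank e (O e) < rank e (O' e))].

Lemma betterP O O' : reflect
  (exists2 e, forall f, (f < e)%O -> O' f = O f & rank e (O e) < rank e (O' e))
  (better O O').
Proof.
apply: (iffP existsP) => [[e /andP[/forallP eq_lt lt_e]]|[e eq_lt lt_e]].
  by exists e => // f /(implyP (eq_lt f))/eqP.
by exists e; rewrite lt_e andbT; apply/forallP=> f; apply/implyP=> /eq_lt->.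
Qed.

Lemma better_irr O : better O O = false.
Proof. by apply/betterP=> -[e _]; rewrite ltnn. Qed.

Lemma better_trans : transitive better.
Proof.
move=> O2 O1 O3 /betterP[e eq_e lt_e] /betterP[f eq_f lt_f]; apply/betterP.
case: (Order.TotalTheory.ltgtP e f) => [ef|fe|ef].
- exists e => [g ge|]; last by rewrite eq_f.
  by rewrite eq_f ?eq_e //; apply: Order.POrderTheory.lt_trans ef.
- exists f => [g gf|]; last by rewrite -eq_e.
  by rewrite eq_f ?eq_e //; apply: Order.POrderTheory.lt_trans fe.
rewrite -{}ef in eq_f lt_f.
by exists e => [g ge|]; [rewrite eq_f ?eq_e | apply: ltn_trans lt_f].
Qed.

Section Full.
Hypothesis fullA : full A.

Lemma agrees_flip x : ~~ oriented A x -> A x.1 = Some (~~ x.2).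
Proof.
move=> Ax; have : oriented A x || oriented A (flip x).
  by apply: oriented_flip; apply: fullA.
by rewrite (negbTE Ax) => /eqP.
Qed.

Lemma improve_cycle O c : directed_cycle G O c -> ~ minimal A c ->
  exists2 O', equivalent G O O' & better O O'.
Proof.
move=> cyc_c not_min; case/andP: (cyc_c) => /andP[c_neq0 _] /allP Oc.
have [x [xc minx /agrees_flip Ax]] := not_minimalP c_neq0 not_min.
exists (reverse O c); first by apply: rt_step; left; exists c.
apply/betterP; exists x.1 => [f fx|].
  rewrite ffunE; case: ifP => // /mapP[y /minx xy fy].
  by move: fx; rewrite fy Order.TotalTheory.ltNge xy.
rewrite ffunE map_f // (eqP (Oc x xc)) /rank Ax /= eqxx.
by case: x.2.
Qed.

(** If the least edge is the unoriented one, only the last pivot is made.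
    Otherwise the part of the path before the least edge [y] is left alone, so
    that [y] itself ends up unoriented. *)
Lemma improve_path O p x : half_open_path G O p x -> ~ minimal A (rcons p x) ->
  exists2 O', equivalent G O O' & better O O'.
Proof.
move=> hop not_min; case/and5P: (hop) => p_neq0 sorted_px uniq_p Op Ox.
have [|y [yp miny /agrees_flip Ay]] := not_minimalP _ not_min.
  by rewrite -size_eq0 size_rcons.
move: yp; rewrite mem_rcons inE => /predU1P[y_x|yp].
  case/lastP: p p_neq0 sorted_px Op miny {hop not_min uniq_p} => // p z _.
  rewrite {}y_x in Ay *.
  rewrite -!cats1 -catA => /cat_sorted2[_ /= /andP[zx _]] Op miny.
  have Oz : oriented O z by move: Op; rewrite all_cat /= => /and3P[].
  exists (pivot O (flip x) z); first exact: pivot_equivalent.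
  apply/betterP; exists x.1 => [f fx|].
    rewrite ffunE /=; case: eqP fx => [->|_ fx].
      by rewrite Order.POrderTheory.ltxx.
    case: eqP => // fz; move: fx.
    by rewrite fz Order.TotalTheory.ltNge miny // mem_cat !inE eqxx orbT.
  by rewrite ffunE /= eqxx (eqP Ox) /rank Ay /= eqxx.
case/splitPr: yp hop miny {not_min p_neq0 sorted_px uniq_p} Op => p1 p2.
move=> hop miny Op.
have [|O' [OO' O'y O'E]] := @push_unoriented _ _ G O y p2 x.
  case/and5P: hop => _; rewrite rcons_cat => /cat_sorted2[_ sorted_px].
  rewrite /edges map_cat cat_uniq all_cat => /and3P[_ _ uniq_p] /andP[_ Op2] _.
  exact/and5P.
exists O' => //; apply/betterP; exists y.1 => [f fy|].
  apply: O'E; rewrite inE; apply/negP=> /mapP[z zp fz].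
  move: fy; rewrite fz Order.TotalTheory.ltNge miny //.
  by rewrite rcons_cat mem_cat zp orbT.
have /eqP-> : oriented O y by apply: (allP Op); rewrite mem_cat mem_head orbT.
by rewrite (eqP O'y) /rank Ay /=; case: y.2.
Qed.

Lemma exists_cycle_path_minimal O :
  exists O', equivalent G O O' /\ cycle_path_minimal G A O'.
Proof.
have [n] := ubnP #|better O|; elim: n O => // n IHn O lt_n.
suff improve : ~ cycle_path_minimal G A O ->
    exists2 O', equivalent G O O' & better O O'.
  case: (classic (cycle_path_minimal G A O)) => [|/improve[O' OO' lt_O]].
    by exists O; split=> //; apply: rt_refl.
  have [|O'' [O'O'' min_O'']] := IHn O'.
    rewrite -ltnS; apply: leq_trans lt_n; rewrite ltnS; apply: proper_card.
    apply/properP; split.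
      by apply/subsetP=> O''; apply: better_trans.
    by exists O' => //; apply: (negbT (better_irr O')).
  by exists O''; split=> //; apply: rt_trans O'O''.
move=> not_min; apply: NNPP => no_improve; case: not_min; split.
  by move=> c cyc_c; apply: NNPP => /(improve_cycle cyc_c)/no_improve.
by move=> p x hop; apply: NNPP => /(improve_path hop)/no_improve.
Qed.

End Full.
End Minimality.

Theorem theorem3p10 (V : finType) (d : Order.disp_t) (E : finOrderType d)
  (G : multigraph V E) (A : partial_orientation E) (O : partial_orientation E) :
  connected G -> full A ->
  exists! O' : partial_orientation E,
    equivalent G O O' /\ cycle_path_minimal G A O'.
Proof.
move=> _ fullA; have [O' [OO' min_O']] := exists_cycle_path_minimal G fullA O.
exists O'; split=> // O'' [OO'' min_O''].
apply: cycle_path_minimal_inj min_O' min_O'' => S.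
by rewrite -(equivalent_indegree S OO') (equivalent_indegree S OO'').
Qed.
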